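(* Let $Q_n$ ($n\ge 3$) denote the twin-prime probability associated with the interval $I_{n-1}=[p_{n-1}^2,p_n^2)$, i.e. the proportion of tuples $C^{(k)}$, $k\in I_{n-1}$, having no entry equal to $0$ or $1$. Assume that there exist real numbers $0<a<b<+\infty$ such that for all $n\ge 3$ $$Q_n=\Theta_n\prod_{j=2}^{n}\left(1-\frac{2}{p_j}\right),\qquad \text{with } a<\Theta_n<b .$$ Then the probability $q_n=1-(1-Q_n)^{T_n}$ that a twin prime pair lies in the interval $I_{n-1}$ satisfies $$\lim_{n\to+\infty} q_n=1 .$$ The same holds true for cousin prime pairs: if $Q_n$ is instead the proportion of tuples $C^{(k)}$, $k\in I_{n-1}$, having no entry equal to $0$ or $2$, and if $Q_n=\Theta_n\prod_{j=2}^{n}(1-2/p_j)$ with $a<\Theta_n<b$ for all $n\ge 3$ and some constants $0<a<b<+\infty$, then $q_n=1-(1-Q_n)^{T_n}\to 1$ as $n\to+\infty$.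
   Context: $p_1=2,p_2=3,p_3=5,\dots$ is the increasing sequence of all primes. A twin prime pair is a pair of primes $(h,h+2)$; a cousin prime pair is a pair of primes $(h,h+4)$. For $n\ge 3$, $I_{n-1}=[p_{n-1}^2,p_n^2)$ denotes the set of odd integers $k$ with $p_{n-1}^2\le k<p_n^2$, and $T_n=\mathrm{Card}(I_{n-1})=(p_n^2-p_{n-1}^2)/2$. For $k\in I_{n-1}$, $C^{(k)}$ is the $(n-1)$-tuple whose entry $C^{(k)}(j-1)$, $j=2,\dots,n$, is the unique element of $\{0,1,\dots,p_j-1\}$ with $k+2C^{(k)}(j-1)\equiv 0 \pmod{p_j}$. For $k\in I_{n-1}$, $(k,k+2)$ is a twin prime pair if and only if no entry of $C^{(k)}$ is $0$ or $1$, and $(k,k+4)$ is a cousin prime pair if and only if no entry of $C^{(k)}$ is $0$ or $2$. $Q_n$ is the probability that a tuple is free of the two forbidden digits ($0,1$ for twin primes; $0,2$ for cousin primes), conditioned on the tuple belonging to $\{C^{(k)}:k\in I_{n-1}\}$, i.e. the relative frequency $$Q_n=\frac{\mathrm{Card}\{k\in I_{n-1}: C^{(k)} \text{ has no entry equal to a forbidden digit}\}}{T_n}.$$ In the probabilistic model used, the $T_n$ tuples are treated as independent trials each with success probability $Q_n$, so the probability that no twin (respectively cousin) pair lies in $I_{n-1}$ is by definition $(1-Q_n)^{T_n}$, and the probability that such a pair lies in $I_{n-1}$ is by definition $q_n=1-(1-Q_n)^{T_n}$. *)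

(* Defs.v *)
From mathcomp Require Import all_boot all_order all_algebra.
From mathcomp Require Import all_classical all_reals all_analysis.
From mathcomp Require Import zify.

Set Implicit Arguments.
Unset Strict Implicit.
Unset Printing Implicit Defensive.

Import Order.TTheory GRing.Theory Num.Theory.
Import numFieldNormedType.Exports.

Local Open Scope nat_scope.

Lemma next_prime_subproof (m : nat) : exists p, (m < p) && prime p.
Proof. by have [p mp pp] := prime_above m; exists p; rewrite mp. Qed.

Definition next_prime (m : nat) : nat := ex_minn (next_prime_subproof m).

(* nth_prime 1 = 2, nth_prime 2 = 3, ...; the value nth_prime 0 = 0 is junk. *)
Definition nth_prime (n : nat) : nat := iter n next_prime 0.

Lemma nth_prime_prime (n : nat) : 0 < n -> prime (nth_prime n).
Proof.
case: n => // n _; rewrite /nth_prime iterS /next_prime.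
by case: ex_minnP => p /andP[].
Qed.

Lemma nth_prime_ltS (n : nat) : nth_prime n < nth_prime n.+1.
Proof.
rewrite /nth_prime iterS {2}/next_prime.
by case: ex_minnP => p /andP[].
Qed.

Lemma nth_prime_mono : {mono nth_prime : m n / m <= n}.
Proof.
apply: leq_mono.
exact: (@homo_ltn _ nth_prime (fun x y => x < y) ltn_trans nth_prime_ltS).
Qed.

Lemma nth_prime_surj (q : nat) : prime q -> exists2 n, 0 < n & nth_prime n = q.
Proof.
move=> pq; have le_nth n : n <= nth_prime n.
  by elim: n => // n IHn; exact: leq_ltn_trans IHn (nth_prime_ltS n).
suff H n : q < nth_prime n -> exists2 m, 0 < m & nth_prime m = q.
  exact: H (le_nth q.+1).
elim: n => [//|n IHn].
have [/IHn //|lt|q_n _] := ltngtP q (nth_prime n); last first.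
  by exists n; rewrite // lt0n; apply/eqP => n0; move: pq; rewrite q_n n0.
rewrite /nth_prime iterS -/(nth_prime n) /next_prime.
case: ex_minnP => p _ /(_ q); rewrite lt pq => /(_ isT) lepq.
by rewrite ltnNge lepq.
Qed.

Lemma odd_nth_prime (j : nat) : 1 < j -> odd (nth_prime j).
Proof.
move=> j1; have pj := nth_prime_prime (ltnW j1).
have p2 : 2 < nth_prime j.
  apply: leq_ltn_trans (prime_gt1 (nth_prime_prime (ltn0Sn 0))) _.
  by rewrite (leq_trans (nth_prime_ltS 1)) // nth_prime_mono.
by have [j2|//] := even_prime pj; rewrite j2 in p2.
Qed.

(* The odd integers of [p_m ^ 2, p_(m+1) ^ 2), without repetition; the index
   n of the statement uses odd_interval n.-1. *)
Definition odd_interval (m : nat) : seq nat :=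
  [seq k <- index_iota (nth_prime m ^ 2) (nth_prime m.+1 ^ 2) | odd k].

Definition card_interval (n : nat) : nat := size (odd_interval n.-1).

Lemma card_intervalE (n : nat) : 2 < n ->
  card_interval n = (nth_prime n ^ 2 - nth_prime n.-1 ^ 2) %/ 2.
Proof.
case: n => [//|m] m2; rewrite /card_interval /odd_interval /= divn2 /index_iota.
have: odd (nth_prime m ^ 2) by rewrite oddX odd_nth_prime.
have: odd (nth_prime m.+1 ^ 2) by rewrite oddX odd_nth_prime // ltnW.
move: (nth_prime m ^ 2) (nth_prime m.+1 ^ 2) => a b ob oa.
have -> : b - a = (b - a)./2.*2 by lia.
rewrite doubleK; move: (b - a)./2 => d; elim: d a oa {ob} => [//|d IHd] a oa.
by rewrite doubleS /= oa /= IHd //= oa.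
Qed.

(* The first c in {0, ..., p_j - 1} such that k + 2 c = 0 mod p_j; by
   digitP it is the only one when j >= 2. *)
Definition digit (k j : nat) : nat :=
  find (fun c => k + 2 * c == 0 %[mod nth_prime j]) (iota 0 (nth_prime j)).

Lemma digitP (k j c : nat) : 1 < j ->
  c = digit k j <-> c < nth_prime j /\ k + 2 * c = 0 %[mod nth_prime j].
Proof.
move=> j1; have op := odd_nth_prime j1.
have pp := nth_prime_prime (ltnW j1); have p0 := prime_gt0 pp.
rewrite /digit; move: (nth_prime j) op pp p0 => p op pp p0.
set P := fun c => _.
have hP : has P (iota 0 p).
  apply/hasP; exists ((k * p./2) %% p); first by rewrite mem_iota ltn_mod.
  rewrite /P -modnDmr modnMmr modnDmr.
  have -> : k + 2 * (k * p./2) = k * p by have := odd_double_half p; nia.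
  by rewrite modnMl mod0n.
have lt_f : find P (iota 0 p) < p by rewrite -[ltnRHS](size_iota 0) -has_find.
have Pf : P (find P (iota 0 p)).
  by have := nth_find 0 hP; rewrite nth_iota.
split=> [->|[ltc Pc]]; first by split => //; exact/eqP.
have uniq_root x y : x <= y -> y < p -> P x -> P y -> x = y.
  move=> lexy ltyp /eqP Px /eqP Py.
  have: 2 * y == 2 * x %[mod p] by rewrite -(eqn_modDl k) Px Py.
  rewrite eqn_mod_dvd ?leq_mul2l // -mulnBr Gauss_dvdr ?coprimen2 // => dvd_p.
  have : y - x = 0 by apply/eqP; move: dvd_p; apply: contraTT; rewrite -lt0n => ?;
    rewrite gtnNdvd //; lia.
  lia.
have Pc' : P c by apply/eqP.
by case/orP: (leq_total c (find P (iota 0 p))) => le;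
  [|symmetry]; apply: uniq_root.
Qed.

(* The entry of index i (counted from 0) is attached to the prime p_(i+2). *)
Definition digit_tuple (n k : nat) : n.-1.-tuple nat :=
  [tuple digit k i.+2 | i < n.-1].

Definition avoids (forbidden t : seq nat) : bool :=
  all (fun c => c \notin forbidden) t.

Definition twin_digits : seq nat := [:: 0; 1].
Definition cousin_digits : seq nat := [:: 0; 2].

Local Open Scope ring_scope.

Definition pair_freq (R : realType) (forbidden : seq nat) (n : nat) : R :=
  (count (fun k => avoids forbidden (digit_tuple n k))
     (odd_interval n.-1))%:R / (card_interval n)%:R.

(* Probability of at least one success among card_interval n independent
   trials, each of success probability pair_freq R forbidden n. *)
Definition pair_prob (R : realType) (forbidden : seq nat) (n : nat) : R :=
  1 - (1 - pair_freq R forbidden n) ^+ card_interval n.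

(* Main.v *)
Require Import Defs.
From mathcomp Require Import all_boot all_order all_algebra.
From mathcomp Require Import all_classical all_reals all_analysis.
From mathcomp Require Import zify ring lra.

Import Order.TTheory GRing.Theory Num.Theory.
Import numFieldNormedType.Exports.

Local Open Scope classical_set_scope.
Local Open Scope ring_scope.

(** Since [(1 - Q) ^ T <= 1 / (1 + T * Q)], it is enough that the expected
    number [T_n * Q_n] of successes tends to infinity.  Two consecutive odd
    primes differ by at least 2, so [T_n = (p_n^2 - p_(n-1)^2) / 2 >= p_n], and
    [T_n * Q_n >= a * W_n] with [W_n = p_n * \prod_(2 <= j <= n) (1 - 2 / p_j)]
    ([sieve_weight]).

    The growth of [W_n] comes from the gaps between primes:
    [W_(n+1) / W_n = (p_(n+1) - 2) / p_n].  If all gaps were equal to 2, this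
    ratio would always be 1; but three odd numbers [p, p+2, p+4]
    with [p > 3] are never all prime, so [p_(n+2) >= p_n + 6]
    ([nth_prime_gap2]), and over two steps [W] grows at least by the factor
    [(p_(n+2) - 2) / (p_n + 2)].  This is roughly [1 + 2 / p] when [p_(n+2)] is
    [p + 6 = p * (1 + 6 / p)], so [W] should grow at least like the cube root
    of [p]; the fourth power leaves room for the lower-order terms, and
    [W_n ^ 4 / p_n] does not decrease from [n] to [n + 2].  Hence
    [p_n <= p_4 * W_n ^ 4] ([nth_prime_le_sieve_weight]) and [W_n] tends to
    infinity.  The forbidden digits enter only through the assumed formula
    for [Q_n], so the twin and cousin cases are the same argument. *)

(** * Gaps between primes *)

Lemma leq_nth_prime (n : nat) : (n <= nth_prime n)%N.
Proof. by elim: n => // n IHn; exact: leq_ltn_trans IHn (nth_prime_ltS n). Qed.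

Lemma nth_prime_gt2 (n : nat) : (1 < n)%N -> (2 < nth_prime n)%N.
Proof.
move=> n1; have := prime_gt1 (nth_prime_prime (ltnW n1)).
by have := odd_nth_prime n1; lia.
Qed.

Lemma nth_prime_gap (n : nat) :
  (1 < n)%N -> (nth_prime n + 2 <= nth_prime n.+1)%N.
Proof.
move=> n1; have := nth_prime_ltS n.
by have := odd_nth_prime n1; have := odd_nth_prime (leqW n1); lia.
Qed.

Lemma prime_mod3 (p : nat) : prime p -> (3 < p)%N -> (p %% 3 != 0)%N.
Proof.
move=> pp p3; apply/negP => d3; have : (3 %| p)%N by [].
by rewrite dvdn_prime2 // => /eqP p_eq; rewrite -p_eq in p3.
Qed.

(** One of [p, p + 2, p + 4] is a multiple of 3. *)
Lemma nth_prime_gap2 (n : nat) :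
  (2 < n)%N -> (nth_prime n + 6 <= nth_prime n.+2)%N.
Proof.
move=> n2.
have p3 : (3 < nth_prime n)%N.
  case: n n2 => // n n2.
  by have := nth_prime_gt2 n n2; have := nth_prime_ltS n; lia.
have g1 := nth_prime_gap n (ltnW n2).
have g2 := nth_prime_gap n.+1 (leqW (ltnW n2)).
have m0 := prime_mod3 _ (nth_prime_prime (ltnW (ltnW n2))) p3.
have m1 : (nth_prime n.+1 %% 3 != 0)%N.
  by apply: prime_mod3; [exact: nth_prime_prime | lia].
have m2 : (nth_prime n.+2 %% 3 != 0)%N.
  by apply: prime_mod3; [exact: nth_prime_prime | lia].
have o0 := odd_nth_prime (ltnW n2).
have o2 := odd_nth_prime (isT : (1 < n.+2)%N).
lia.
Qed.

Lemma card_interval_ge (n : nat) :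
  (2 < n)%N -> (nth_prime n <= card_interval n)%N.
Proof.
case: n => // n n2; rewrite card_intervalE // [n.+1.-1]/= leq_divRL //.
rewrite subn_sqr mulnC leq_mul ?leq_addr //.
by have := nth_prime_gap n n2; lia.
Qed.

(** * Growth of the sieve product *)

Implicit Types R : realType.

Definition sieve_weight R (n : nat) : R :=
  (nth_prime n)%:R * \prod_(2 <= j < n.+1) (1 - 2 / (nth_prime j)%:R).

Lemma nth_primeR_gt2 R (n : nat) : (1 < n)%N -> 2 < (nth_prime n)%:R :> R.
Proof. by move=> n1; rewrite ltr_nat nth_prime_gt2. Qed.

Lemma sieve_weightS R (n : nat) : (1 < n)%N ->
  sieve_weight R n.+1 =
    sieve_weight R n * (((nth_prime n.+1)%:R - 2) / (nth_prime n)%:R).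
Proof.
move=> n1; rewrite /sieve_weight big_nat_recr /=; last by lia.
have p2 := nth_primeR_gt2 R n n1; have q2 := nth_primeR_gt2 R n.+1 (leqW n1).
by field; apply/andP; split; apply: lt0r_neq0; lra.
Qed.

Lemma sieve_weight_ge1 R (n : nat) : (1 < n)%N -> 1 <= sieve_weight R n.
Proof.
elim: n => // n IHn; rewrite ltnS leq_eqVlt => /predU1P[<-|n1].
  rewrite /sieve_weight big_nat1.
  have p3 : 3 <= (nth_prime 2)%:R :> R by rewrite ler_nat nth_prime_gt2.
  have -> : (nth_prime 2)%:R * (1 - 2 / (nth_prime 2)%:R) =
            (nth_prime 2)%:R - 2 :> R by field; apply: lt0r_neq0; lra.
  lra.
rewrite sieve_weightS //; apply: (le_trans (IHn n1)).
have p2 := nth_primeR_gt2 R n n1.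
rewrite ler_peMr ?(le_trans ler01) ?IHn //.
rewrite ler_pdivlMr ?mul1r; last by lra.
have := nth_prime_gap n n1; rewrite -(ler_nat R) natrD; lra.
Qed.

(** The extremal case is [q = p + 2], [r = p + 6], where the right-hand side is
    [((p + 4) / (p + 2)) ^ 4], about [1 + 8 / p], against [1 + 6 / p]. *)
Lemma two_step_growth R (p q r : R) : 1 <= p -> p + 2 <= q -> p + 6 <= r ->
  r / p <= ((q - 2) / p * ((r - 2) / q)) ^+ 4.
Proof.
move=> p1 pq pr.
(* (q - 2) / q is smallest at q = p + 2. *)
have lower : (r - 2) / (p + 2) <= (q - 2) / p * ((r - 2) / q).
  rewrite mulf_div ler_pdivrMr; last by lra.
  rewrite mulrAC ler_pdivlMr; last by nra.
  rewrite -subr_ge0 [leRHS](_ : _ = (r - 2) * (2 * (q - (p + 2)))).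
    by apply: mulr_ge0; lra.
  by ring.
have lower_ge0 : 0 <= (r - 2) / (p + 2) by apply: divr_ge0; lra.
apply: le_trans (lerXn2r 4 _ _ lower); rewrite ?nnegrE //; last first.
  exact: le_trans lower.
rewrite expr_div_n ler_pdivrMr; last by lra.
rewrite mulrAC ler_pdivlMr; last by apply: exprn_gt0; lra.
(* As a polynomial in t = p - 1 and s = r - (p + 6), the difference of the two
   sides has nonnegative coefficients. *)
have [t t0 p_eq] : exists2 t, 0 <= t & p = 1 + t by exists (p - 1); [lra | ring].
have [s s0 ->] : exists2 s, 0 <= s & r = p + 6 + s.
  by exists (r - (p + 6)); [lra | ring].
rewrite p_eq -subr_ge0.
have -> : (1 + t + 6 + s - 2) ^+ 4 * (1 + t) - (1 + t + 6 + s) * (1 + t + 2) ^+ 4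
  = 2 * t ^+ 4 + 32 * t ^+ 3 + 164 * t ^+ 2 + 288 * t + 58
    + (3 * t ^+ 4 + 52 * t ^+ 3 + 306 * t ^+ 2 + 692 * t + 419) * s
    + (1 + t) * (6 * (t + 5) ^+ 2 + 4 * (t + 5) * s + s ^+ 2) * s ^+ 2.
  ring.
by rewrite !(addr_ge0, mulr_ge0, exprn_ge0).
Qed.

(** The exponent 4 is the least integer above 3, the critical value at which
    [(1 + 2 / p) ^ 3] and [(p + 6) / p] agree to first order.  The constant
    [nth_prime 4] makes both starting points [n = 3] and [n = 4] of the two-step
    induction follow from [1 <= sieve_weight R n]. *)
Lemma nth_prime_le_sieve_weight R (n : nat) : (2 < n)%N ->
  (nth_prime n)%:R <= (nth_prime 4)%:R * sieve_weight R n ^+ 4.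
Proof.
have base m : (2 < m <= 4)%N ->
    (nth_prime m)%:R <= (nth_prime 4)%:R * sieve_weight R m ^+ 4.
  move=> /andP[m2 m4]; apply: (@le_trans _ _ (nth_prime 4)%:R).
    by rewrite ler_nat nth_prime_mono.
  by rewrite ler_peMr // exprn_ege1 // sieve_weight_ge1 // ltnW.
elim/ltn_ind: n => n IHn n2; have [n4|n4] := leqP n 4; first by rewrite base ?n2.
case: n n4 n2 IHn => [//|[//|n]] n4 _ IHn.
have n2 : (2 < n)%N by lia.
have {IHn} IHn := IHn n (ltnW (ltnSn _)) n2.
rewrite sieve_weightS ?ltnS ?(ltnW (ltnW n2)) // sieve_weightS ?(ltnW n2) //.
have p2 := nth_primeR_gt2 R n (ltnW n2).
have := nth_prime_gap n (ltnW n2); rewrite -(ler_nat R) natrD => g1.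
have := nth_prime_gap2 n n2; rewrite -(ler_nat R) natrD => g2.
have grow := two_step_growth R _ _ _ (ltW (lt_trans (ltr1n R 2) p2)) g1 g2.
rewrite -mulrA exprMn mulrA.
apply: le_trans (ler_pM _ _ IHn grow); rewrite ?ler0n ?divr_ge0 //.
by rewrite mulrC divfK // lt0r_neq0 // (lt_trans _ p2).
Qed.

Lemma sieve_weight_cvgy R : sieve_weight R n @[n --> \oo] --> +oo.
Proof.
apply/cvgryPge => A.
have : \forall n \near \oo, (nth_prime 4)%:R * A ^+ 4 < n%:R :> R.
  exact: nbhs_infty_gtr.
move=> H; near=> n.
have n2 : (2 < n)%N by near: n; exact: nbhs_infty_gt.
have W1 : 1 <= sieve_weight R n by rewrite sieve_weight_ge1 // ltnW.
rewrite leNgt; apply/negP => WA.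
have : (nth_prime 4)%:R * A ^+ 4 < n%:R by near: n.
apply/negP; rewrite -leNgt.
apply: (@le_trans _ _ (nth_prime n)%:R); first by rewrite ler_nat leq_nth_prime.
apply: le_trans (nth_prime_le_sieve_weight R n n2) _.
by apply: ler_wpM2l => //; apply: lerXn2r; rewrite ?nnegrE; lra.
Unshelve. all: by end_near. Qed.

(** * Independent trials *)

(** The product [(1 - Q) ^ T * (1 + T * Q)] equals 1 at [T = 0] and does not
    increase with [T]. *)
Lemma no_success_le R (Q : R) (T : nat) :
  0 <= Q <= 1 -> (1 - Q) ^+ T <= (1 + T%:R * Q)^-1.
Proof.
move=> /andP[Q0 Q1].
have TQ0 (m : nat) : 0 <= m%:R * Q by rewrite mulr_ge0.
rewrite -[leRHS]mul1r ler_pdivlMr; last by have := TQ0 T; lra.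
elim: T => [|T IHT]; first by rewrite expr0 mul1r mul0r addr0.
apply: le_trans IHT; rewrite exprSr -mulrA ler_wpM2l ?exprn_ge0 //; first by lra.
rewrite -subr_ge0.
have -> : 1 + T%:R * Q - (1 - Q) * (1 + T.+1%:R * Q) = T.+1%:R * Q * Q.
  by rewrite -natr1; ring.
by rewrite mulr_ge0.
Qed.

Lemma some_success_cvg1 R (Q : nat -> R) (T : nat -> nat) :
  (forall n, 0 <= Q n <= 1) -> ((T n)%:R * Q n @[n --> \oo] --> +oo) ->
  1 - (1 - Q n) ^+ T n @[n --> \oo] --> (1 : R).
Proof.
move=> Q01 TQ; rewrite -[X in _ --> X]subr0.
apply: cvgB; first exact: cvg_cst.
have TQ1 : 1 + (T n)%:R * Q n @[n --> \oo] --> +oo.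
  apply: ger_cvgy TQ; apply: nearW => n; lra.
have inv0 : (1 + (T n)%:R * Q n)^-1 @[n --> \oo] --> (0 : R).
  apply/gtr0_cvgV0 => //; apply: nearW => n.
  by have /andP[Qn0 _] := Q01 n; rewrite ltr_pwDl // mulr_ge0.
apply: (squeeze_cvgr _ (cvg_cst 0) inv0); apply: nearW => n.
have /andP[Qn0 Qn1] := Q01 n.
by rewrite no_success_le // andbT exprn_ge0 // subr_ge0.
Qed.

Lemma pair_freq_itv R (forbidden : seq nat) (n : nat) :
  0 <= pair_freq R forbidden n <= 1.
Proof.
rewrite /pair_freq divr_ge0 //=; have [->|T0] := posnP (card_interval n).
  by rewrite invr0 mulr0.
by rewrite ler_pdivrMr ?ltr0n // mul1r ler_nat count_size.
Qed.

Lemma pair_prob_cvg1 R (forbidden : seq nat) (a b : R) (Theta : nat -> R) :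
  0 < a ->
  (forall n : nat, (3 <= n)%N ->
     pair_freq R forbidden n =
       Theta n * \prod_(2 <= j < n.+1) (1 - 2 / (nth_prime j)%:R)
     /\ a < Theta n < b) ->
  pair_prob R forbidden n @[n --> \oo] --> (1 : R).
Proof.
move=> a0 HQ; apply: some_success_cvg1; first exact: pair_freq_itv.
have aW : a * sieve_weight R n @[n --> \oo] --> +oo.
  apply/cvgryPge => A; near do rewrite mulrC -ler_pdivrMr //.
  by move/cvgryPge: (sieve_weight_cvgy R); apply.
apply: ger_cvgy aW; near=> n.
have n2 : (2 < n)%N by near: n; exact: nbhs_infty_gt.
have [QE /andP[aT _]] := HQ n n2.
have P0 : 0 <= \prod_(2 <= j < n.+1) (1 - 2 / (nth_prime j)%:R) :> R.
  rewrite big_nat; apply: prodr_ge0 => j /andP[j2 _].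
  have p2 := nth_primeR_gt2 R j j2.
  by rewrite subr_ge0 ler_pdivrMr ?mul1r ?ltW // (lt_trans _ p2).
rewrite QE /sieve_weight mulrCA; apply: ler_pM.
- by [].
- by rewrite mulr_ge0 // ltW.
- by rewrite ler_nat card_interval_ge.
- by rewrite ler_wpM2r // ltW.
Unshelve. all: by end_near. Qed.

Theorem theorem3p7 (R : realType) :
  ((exists (a b : R) (Theta : nat -> R),
      [/\ 0 < a, a < b &
          forall n : nat, (3 <= n)%N ->
            pair_freq R twin_digits n =
              Theta n * \prod_(2 <= j < n.+1) (1 - 2 / (nth_prime j)%:R)
            /\ a < Theta n < b]) ->
   pair_prob R twin_digits n @[n --> \oo] --> (1 : R))
  /\
  ((exists (a b : R) (Theta : nat -> R),
      [/\ 0 < a, a < b &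
          forall n : nat, (3 <= n)%N ->
            pair_freq R cousin_digits n =
              Theta n * \prod_(2 <= j < n.+1) (1 - 2 / (nth_prime j)%:R)
            /\ a < Theta n < b]) ->
   pair_prob R cousin_digits n @[n --> \oo] --> (1 : R)).
Proof.
by split=> -[a [b [th [a0 _ HQ]]]]; exact: (pair_prob_cvg1 _ _ a b th).
Qed.
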